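(* Let $\Pi$ be one of the following sets of patterns: $\{132,312\}$, $\{132,321\}$, $\{213,231\}$, $\{123,132,312\}$, $\{123,213,231\}$, $\{123,312,321\}$, $\{132,312,321\}$, $\{213,231,312\}$, or $\{213,231,321\}$. Then, for all $n\geq 0$, the pairs of statistics $(\mathrm{fix},\mathrm{des})$ and $(\mathrm{pix},\mathrm{des})$ are equidistributed over $\mathfrak{S}_n(\Pi)$; that is, for all integers $j,k\ge 0$, the number of $\pi\in\mathfrak{S}_n(\Pi)$ with $\mathrm{fix}(\pi)=j$ and $\mathrm{des}(\pi)=k$ equals the number of $\pi\in\mathfrak{S}_n(\Pi)$ with $\mathrm{pix}(\pi)=j$ and $\mathrm{des}(\pi)=k$.
   Context: $\mathfrak{S}_n$ is the set of permutations $\pi=\pi_1\pi_2\cdots\pi_n$ of $[n]=\{1,\dots,n\}$ in one-line notation; $\mathfrak{S}_0$ consists of the empty permutation. The standardization of a sequence of distinct positive integers of length $m$ is the permutation in $\mathfrak{S}_m$ obtained by replacing its smallest letter by 1, the second smallest by 2, and so on. A permutation $\pi$ avoids a pattern $\sigma$ if no (not necessarily consecutive) subsequence of $\pi$ has standardization $\sigma$. $\mathfrak{S}_n(\Pi)$ is the set of permutations in $\mathfrak{S}_n$ avoiding every pattern in $\Pi$. $\mathrm{fix}(\pi)$ is the number of $i\in[n]$ with $\pi_i=i$. An index $i\in[n-1]$ is a descent of $\pi$ if $\pi_i>\pi_{i+1}$ and an ascent if $\pi_i<\pi_{i+1}$; $\mathrm{des}(\pi)$ is the number of descents. These notions of ascent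 and descent also apply to sequences of distinct positive integers. An index $i\in [n]$ is a non-descent if $i$ is an ascent or $i=n$. A desarrangement is a sequence of distinct positive integers whose first (smallest) non-descent is even; the empty sequence is also a desarrangement. Every permutation $\pi$ can be written uniquely as a concatenation $\pi=\iota\delta$ where $\iota$ is an increasing (possibly empty) sequence and $\delta$ is a desarrangement (possibly empty); $\mathrm{pix}(\pi)$ is the length of $\iota$. *)

(* Defs.v *)
From mathcomp Require Import all_boot all_fingroup.

Set Implicit Arguments.
Unset Strict Implicit.
Unset Printing Implicit Defensive.

(* Sequences of distinct positive integers are values of [seq nat]. Positions
   are numbered from 1 as in [n] = {1, ..., n}, so the letter at position i of
   s is [nth 0 s i.-1]. *)

Definition standardize (s : seq nat) : seq nat :=
  [seq count (fun y => y <= x) s | x <- s].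

(* The masks m select exactly the (not necessarily consecutive) subsequences. *)
Definition contains (s sigma : seq nat) : bool :=
  [exists m : (size s).-tuple bool, standardize (mask m s) == sigma].

Definition avoids (s : seq nat) (Pi : seq (seq nat)) : bool :=
  all (fun sigma => ~~ contains s sigma) Pi.

Definition is_descent (s : seq nat) (i : nat) : bool :=
  (0 < i < size s) && (nth 0 s i < nth 0 s i.-1).

Definition is_ascent (s : seq nat) (i : nat) : bool :=
  (0 < i < size s) && (nth 0 s i.-1 < nth 0 s i).

Definition is_nondescent (s : seq nat) (i : nat) : bool :=
  (0 < i <= size s) && (is_ascent s i || (i == size s)).

Definition word_des (s : seq nat) : nat :=
  count (is_descent s) (iota 1 (size s).-1).

(* Only meaningful for nonempty s: position [size s] is then a non-descent. *)
Definition first_nondescent (s : seq nat) : nat :=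
  (find (is_nondescent s) (iota 1 (size s))).+1.

Definition desarrangement (s : seq nat) : bool :=
  (s == [::]) || ~~ odd (first_nondescent s).

Definition pix_split (s : seq nat) (k : nat) : bool :=
  sorted ltn (take k s) && desarrangement (drop k s).

(* [word_pixP] below shows that for distinct letters exactly one k <= size s
   satisfies [pix_split s k], so searching for the least one is harmless. *)
Definition word_pix (s : seq nat) : nat :=
  find (pix_split s) (iota 0 (size s).+1).

Section Permutations.

Variable n : nat.
Implicit Type p : 'S_n.

Definition one_line p : seq nat := [seq (p i).+1 | i <- enum 'I_n].

Definition Av (Pi : seq (seq nat)) : {set 'S_n} :=
  [set p | avoids (one_line p) Pi].

Definition fixs p : nat := #|[set i | p i == i]|.

Definition des p : nat := word_des (one_line p).

Definition pix p : nat := word_pix (one_line p).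

End Permutations.

Lemma containsP s sigma :
  reflect (exists2 t, subseq t s & standardize t = sigma) (contains s sigma).
Proof.
apply: (iffP existsP) => [[m /eqP <-]|[t /subseqP[m sz_m ->] <-]].
  by exists (mask m s) => //; apply: mask_subseq.
by exists (Tuple (introT eqP sz_m)).
Qed.

Lemma first_nondescent_cons x y s :
  x != y ->
  first_nondescent (x :: y :: s)
    = if x < y then 1 else (first_nondescent (y :: s)).+1.
Proof.
move=> neq_xy; rewrite /first_nondescent /= {1}/is_nondescent /is_ascent /=.
rewrite orbF; case: ltnP => //= _.
congr _.+2; rewrite -[2]/(1 + 1) -[iota 2 _]/(iota (1 + 1) (size s)).
rewrite -[RHS]/(find (is_nondescent (y :: s)) (iota 1 (size s).+1)).
rewrite -[LHS]/(find (is_nondescent [:: x, y & s]) (iota (1 + 1) (size s).+1)).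
rewrite iotaDl find_map; apply: eq_in_find => i.
by rewrite mem_iota => /andP[i_gt0 _]; case: i i_gt0 => //= i _.
Qed.

Lemma desarrangement_cons x y s :
  x != y ->
  desarrangement (x :: y :: s) = (y < x) && ~~ desarrangement (y :: s).
Proof.
move=> neq_xy; rewrite /desarrangement first_nondescent_cons // !orFb.
by move: neq_xy; case: ltngtP => // _ _; rewrite oddS.
Qed.

Lemma pix_split_unique s :
  uniq s -> exists2 k, k <= size s &
    forall l, l <= size s -> pix_split s l = (l == k).
Proof.
elim: s => [|x [|y s] IHs] uniq_s; first by exists 0 => // -[].
  by exists 1 => // -[|[]].
have neq_xy : x != y.
  by move: uniq_s => /= /andP[]; rewrite inE negb_or => /andP[].
have [k le_k Pk] : exists2 k, k <= size (y :: s) &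
    forall l, l <= size (y :: s) -> pix_split (y :: s) l = (l == k).
  by apply: IHs; case/andP: uniq_s.
have P0 := Pk 0 isT; rewrite /pix_split /= in P0.
case: (ltnP x y) => [lt_xy | le_yx].
  exists k.+1 => // -[_|l le_l].
    by rewrite /pix_split /= desarrangement_cons // ltnNge (ltnW lt_xy).
  rewrite eqSS -Pk // /pix_split /=; case: l le_l => //= l _.
  by rewrite lt_xy.
have lt_yx : y < x by rewrite ltn_neqAle eq_sym neq_xy.
exists (k == 0) => [|[|[|l]] le_l]; first by case: (k == 0).
- by rewrite /pix_split /= desarrangement_cons // lt_yx P0; case: k {le_k Pk P0}.
- by rewrite /pix_split /= P0; case: k {le_k Pk P0}.
by rewrite /pix_split /= ltnNge le_yx; case: (k == 0).
Qed.

Lemma word_pixP s k :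
  uniq s -> k <= size s -> pix_split s k = (k == word_pix s).
Proof.
move=> /pix_split_unique[l le_l Pl] le_k; rewrite Pl //; congr (_ == _).
have has_l : has (pix_split s) (iota 0 (size s).+1).
  by apply/hasP; exists l; [rewrite mem_iota add0n ltnS | rewrite Pl].
have lt_f : word_pix s < (size s).+1.
  by move: has_l; rewrite has_find size_iota.
have := nth_find 0 has_l; rewrite nth_iota // add0n Pl; last exact: lt_f.
by move/eqP.
Qed.

Lemma word_pix_size s : uniq s -> word_pix s <= size s.
Proof.
move=> /pix_split_unique[l le_l Pl]; rewrite -ltnS.
have : has (pix_split s) (iota 0 (size s).+1).
  by apply/hasP; exists l; [rewrite mem_iota add0n ltnS | rewrite Pl].
by rewrite has_find size_iota.
Qed.

Lemma one_line_uniq n (p : 'S_n) : uniq (one_line p).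
Proof.
rewrite map_inj_uniq ?enum_uniq // => i j [] /val_inj; exact: perm_inj.
Qed.

(* Main.v *)
(* The statistics pix and des depend only on the descent word.  Avoiding
   213 and 231 means that every letter is the least or the greatest of those
   remaining, so such a permutation is recovered from its descent word w.  For
   both fix and pix a leading ascent of w adds one; once w starts with a descent,
   fix and pix are 0 or 1, according to whether a certain path meets a diagonal
   and to the parity of the initial run of descents, and these two events are
   equally frequent for each length and number of descents because their counts
   satisfy the same recurrence.  Requiring also 123, 321 or 312 to be avoided
   restricts the number of ascents or descents, or makes w sorted.
   Reverse-complement preserves fix, reverses w, and exchanges {132,312} with
   {213,231}.  The permutations avoiding 132 and 321 are the identity and the
   nontrivial rotations of an initial segment [1..m]; those avoiding 123 and 321
   have size at most 4. *)

Require Import Defs.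
From mathcomp Require Import all_boot all_fingroup.
From mathcomp Require Import zify.

Set Implicit Arguments.
Unset Strict Implicit.
Unset Printing Implicit Defensive.

(** * Pattern avoidance for patterns of length three *)

(** The ternary analogue of [pairwise]. It turns avoidance of a pattern of length three into a
    recursion on the word, in step with the recursion of [peel]. *)
Fixpoint triplewise (r : nat -> nat -> nat -> bool) (s : seq nat) : bool :=
  if s is x :: t then pairwise (r x) t && triplewise r t else true.

Lemma pairwise_subseqP (r : rel nat) s :
  reflect (forall x y, subseq [:: x; y] s -> r x y) (pairwise r s).
Proof.
apply: (iffP idP) => [r_s x y /subseq_pairwise/(_ r_s)|].
  by rewrite /= andbT => /andP[].
elim: s => //= x s IHs r_s; apply/andP; split.
  by apply/allP=> y ys; apply: r_s; rewrite eqxx sub1seq.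
apply: IHs => y z yzs; apply: r_s; exact: subseq_trans yzs (subseq_cons s x).
Qed.

Lemma triplewise_subseqP (r : nat -> nat -> nat -> bool) s :
  reflect (forall x y z, subseq [:: x; y; z] s -> r x y z) (triplewise r s).
Proof.
apply: (iffP idP).
  elim: s => //= a s IHs /andP[/pairwise_subseqP ra rs] x y z.
  by case: eqP => [->|_]; [apply: ra | apply: IHs].
elim: s => //= a s IHs r_s; apply/andP; split.
  by apply/pairwise_subseqP => y z yzs; apply: r_s; rewrite eqxx.
apply: IHs => x y z xyzs; apply: r_s; exact: subseq_trans xyzs (subseq_cons s a).
Qed.

Lemma triplewise_nth (r : nat -> nat -> nat -> bool) s :
  (forall i j k, i < j < k -> k < size s ->
    r (nth 0 s i) (nth 0 s j) (nth 0 s k)) ->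
  triplewise r s.
Proof.
elim: s => //= a s IHs r_s; apply/andP; split.
  by apply/(pairwiseP 0) => i j _ lt_j lt_ij; apply: (r_s 0 i.+1 j.+1).
by apply: IHs => i j k lt_ijk lt_k; apply: (r_s i.+1 j.+1 k.+1).
Qed.

Lemma eq_in_triplewise (r r' : nat -> nat -> nat -> bool) s :
  {in s & &, forall x y z, r x y z = r' x y z} ->
  triplewise r s = triplewise r' s.
Proof.
move=> eq_r; apply/triplewise_subseqP/triplewise_subseqP => r_s x y z xyz;
  have sub := mem_subseq xyz; move: (r_s x y z xyz);
  by rewrite eq_r //; apply: sub; rewrite !inE eqxx ?orbT.
Qed.

Lemma eq_triplewise (r r' : nat -> nat -> nat -> bool) s :
  (forall x y z, r x y z = r' x y z) -> triplewise r s = triplewise r' s.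
Proof. by move=> eq_r; apply: eq_in_triplewise. Qed.

Lemma triplewise_map r h s :
  triplewise r (map h s) = triplewise (fun x y z => r (h x) (h y) (h z)) s.
Proof. by elim: s => //= a s ->; rewrite pairwise_map. Qed.

Lemma triplewise_rev r s :
  triplewise r (rev s) = triplewise (fun x y z => r z y x) s.
Proof.
by apply/triplewise_subseqP/triplewise_subseqP => r_s x y z xyz; apply: r_s;
  rewrite -subseq_rev ?revK.
Qed.

Lemma triplewise_rcons r s m :
  triplewise r (rcons s m) =
    pairwise (fun x y => r x y m) s && triplewise r s.
Proof.
elim: s => //= a s ->; rewrite pairwise_rcons.
by case: (all _ s); case: (pairwise (r a) s); rewrite ?andbF.
Qed.

Lemma avoid_triplewise s a b c :
  ~~ contains s [:: a; b; c] =
    triplewise (fun x y z => standardize [:: x; y; z] != [:: a; b; c]) s.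
Proof.
apply/negP/triplewise_subseqP => [nc x y z xyz|av /containsP[t]].
  by apply/negP => /eqP std; apply: nc; apply/containsP; exists [:: x; y; z].
case: t => [|x [|y [|z [|]]]] // xyz /eqP std.
by have := av _ _ _ xyz; rewrite std.
Qed.

Section StandardizedTriples.

Variables x y z : nat.
Let std := standardize [:: x; y; z].

(** Equal letters receive equal ranks, so a tie matches no pattern, just as it satisfies none of the
    strict chains. *)
Lemma standardize3 :
  [/\ (std == [:: 1; 2; 3]) = (x < y < z), (std == [:: 1; 3; 2]) = (x < z < y),
      (std == [:: 2; 1; 3]) = (y < x < z), (std == [:: 2; 3; 1]) = (z < x < y) &
      (std == [:: 3; 1; 2]) = (y < z < x) /\ (std == [:: 3; 2; 1]) = (z < y < x)].
Proof.
rewrite /std /standardize /= !eqseq_cons !leqnn !andbT.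
by case: (ltngtP x y); case: (ltngtP x z); case: (ltngtP y z); (try lia) => *.
Qed.

End StandardizedTriples.

Lemma avoid3E s :
  [/\ ~~ contains s [:: 1; 2; 3] = triplewise (fun x y z => ~~ (x < y < z)) s,
      ~~ contains s [:: 1; 3; 2] = triplewise (fun x y z => ~~ (x < z < y)) s,
      ~~ contains s [:: 2; 1; 3] = triplewise (fun x y z => ~~ (y < x < z)) s,
      ~~ contains s [:: 2; 3; 1] = triplewise (fun x y z => ~~ (z < x < y)) s &
      ~~ contains s [:: 3; 1; 2] = triplewise (fun x y z => ~~ (y < z < x)) s /\
      ~~ contains s [:: 3; 2; 1] = triplewise (fun x y z => ~~ (z < y < x)) s].
Proof.
by split=> [||||]; [..|split]; rewrite avoid_triplewise; apply: eq_triplewise => x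
    y z;
  case: (standardize3 x y z) => e1 e2 e3 e4 [e5 e6]; congr (~~ _).
Qed.

(** * One-line notation *)

Definition word_fix (s : seq nat) : nat :=
  count (fun i => nth 0 s i == i.+1) (iota 0 (size s)).

(** Reverse-complement, meant for words with letters in [1..n]. *)
Definition rc n s : seq nat := rev [seq n.+1 - x | x <- s].

Section OneLine.

Variable n : nat.

Lemma size_one_line (p : 'S_n) : size (one_line p) = n.
Proof. by rewrite size_map size_enum_ord. Qed.

Lemma nth_one_line (p : 'S_n) (i : 'I_n) : nth 0 (one_line p) i = (p i).+1.
Proof. by rewrite (nth_map i) ?size_enum_ord // nth_ord_enum. Qed.

Lemma perm_one_line (p : 'S_n) : perm_eq (one_line p) (iota 1 n).
Proof.
apply: uniq_perm; rewrite ?one_line_uniq ?iota_uniq // => y.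
rewrite mem_iota; apply/mapP/idP => [[i _ ->]|/andP[y0 yn]] //.
  by rewrite add1n /=; exact: ltn_ord.
have lt_y : y.-1 < n by lia.
exists (p^-1 (Ordinal lt_y))%g; first by rewrite mem_enum.
by rewrite permKV /= prednK.
Qed.

Lemma one_line_inj : injective (@one_line n).
Proof.
move=> p q eq_pq; apply/permP => i; apply/val_inj/eqP; rewrite -eqSS.
by rewrite -!nth_one_line eq_pq.
Qed.

Lemma one_line_onto s : perm_eq s (iota 1 n) -> exists p : 'S_n, one_line p = s.
Proof.
move=> s_n; have sz : size s = n by rewrite (perm_size s_n) size_iota.
have in_s (i : 'I_n) : 0 < nth 0 s i < n.+1.
  by have := mem_nth 0 (s := s) (n := i); rewrite sz (perm_mem s_n) mem_iota => ->.
have lt_s (i : 'I_n) : (nth 0 s i).-1 < n by have := in_s i; lia.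
have inj : injective (fun i => Ordinal (lt_s i)).
  move=> i j [eq_ij]; apply/val_inj/eqP.
  have eq_nth : nth 0 s i = nth 0 s j by have := in_s i; have := in_s j; lia.
  rewrite -(@nth_uniq _ 0 s) ?sz ?ltn_ord ?(perm_uniq s_n) ?iota_uniq //.
  exact/eqP.
exists (perm inj); apply: (@eq_from_nth _ 0); rewrite size_one_line // => i lt_i.
rewrite (nth_one_line _ (Ordinal lt_i)) permE /= prednK //.
by have /andP[] := in_s (Ordinal lt_i).
Qed.

Lemma fixs_one_line (p : 'S_n) : fixs p = word_fix (one_line p).
Proof.
rewrite /fixs /word_fix size_one_line -val_enum_ord count_map cardE size_filter.
rewrite -enumT; apply: eq_count => i; by rewrite !inE /= nth_one_line eqSS.
Qed.

End OneLine.
(** * Descent words *)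

Definition descent_word (s : seq nat) : bitseq :=
  if s is x :: t then pairmap (fun x y => y < x) x t else [::].

(* For a leading descent this is 1 exactly when the rest of the word contributes
   0, because [desarrangement_cons] flips the parity. *)
Fixpoint pix_of_word (w : bitseq) : nat :=
  if w is b :: v then
    if b then nat_of_bool (pix_of_word v == 0) else (pix_of_word v).+1
  else 1.

Lemma size_descent_word s : size (descent_word s) = (size s).-1.
Proof. by case: s => //= x t; rewrite size_pairmap. Qed.

Lemma word_desE s : word_des s = count id (descent_word s).
Proof.
rewrite /word_des; case: s => // x t /=.
rewrite -[1]addn0 iotaDl count_map -[pairmap _ x t](mkseq_nth false).
rewrite size_pairmap count_map; apply: eq_in_count => i.
rewrite mem_iota => /andP[_ lt_i] /=.
by rewrite (nth_pairmap 0) // /is_descent /= ltnS lt_i.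
Qed.

(** By uniqueness of the split it suffices to exhibit one of the claimed length. A smaller [x]
    extends the increasing prefix. A larger [x] flips whether the whole word is a desarrangement:
    either [x] alone becomes the prefix, or the prefix is empty. *)
Lemma word_pix_cons x y s : uniq [:: x, y & s] ->
  word_pix [:: x, y & s] =
    if x < y then (word_pix (y :: s)).+1 else nat_of_bool (word_pix (y :: s) == 0).
Proof.
move=> uniq_xys; have uniq_ys : uniq (y :: s) by case/andP: uniq_xys.
have le_pix := word_pix_size uniq_ys; have split_pix := word_pixP uniq_ys.
have neq_xy : x != y.
  by move: uniq_xys => /= /andP[]; rewrite inE negb_or => /andP[].
apply/esym/eqP; rewrite -word_pixP //; last first.
  by case: ifP => _ //; apply: leq_trans (leq_b1 _) _.
case: ifPn => [lt_xy | nlt_xy].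
  have := split_pix _ le_pix; rewrite eqxx => /andP[sorted_ys des_ys].
  rewrite /pix_split /= des_ys andbT.
  by case: (word_pix _) sorted_ys => //= m; rewrite lt_xy.
have lt_yx : y < x by rewrite ltn_neqAle eq_sym neq_xy leqNgt.
have := split_pix 0 isT; rewrite /pix_split /= eq_sym.
case: (word_pix _ == 0) => /= ds; first by rewrite ds.
by rewrite desarrangement_cons // lt_yx ds.
Qed.

(** The empty word and a single letter share the empty descent word but have pix 0 and 1, which is
    why size 0 is treated separately. *)
Lemma word_pixE s : uniq s -> s != [::] -> word_pix s = pix_of_word (descent_word
    s).
Proof.
elim: s => // x [|y s] IHs uniq_s _; first by [].
have uniq_ys : uniq (y :: s) by case/andP: uniq_s.
rewrite word_pix_cons // IHs //=.
have neq_xy : x != y.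
  by move: uniq_s => /= /andP[]; rewrite inE negb_or => /andP[].
by case: ltngtP neq_xy.
Qed.

(** * Joint counts of fix, pix and descents over binary words *)

Fixpoint words n : seq bitseq :=
  if n is m.+1 then map (cons false) (words m) ++ map (cons true) (words m)
  else [:: [::]].

Lemma mem_words n w : (w \in words n) = (size w == n).
Proof.
have mem_cons b c v s : (b :: v \in map (cons c) s) = (b == c) && (v \in s).
  apply/mapP/andP => [[u us [-> ->]]|[/eqP -> vs]] //; by exists v.
elim: n w => [|n IHn] [|b w] //=; first by rewrite mem_cat; apply/norP; split;
    apply/mapP => -[].
by rewrite mem_cat !mem_cons IHn eqSS; case: b; rewrite ?orbF.
Qed.

Lemma words_uniq n : uniq (words n).
Proof.
elim: n => //= n IHn; rewrite cat_uniq !map_inj_uniq ?IHn /= ?andbT; try by move=>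
    ? ? [].
by apply/hasP => -[w /mapP[v _ ->] /mapP[]].
Qed.

Lemma count_words_cons n (P : pred bitseq) :
  count P (words n.+1) =
    count (fun w => P (false :: w)) (words n) + count (fun w => P (true :: w))
        (words n).
Proof. by rewrite /= count_cat !count_map. Qed.

(** [words] branches on the first letter; branching on the last one as well allows words to be
    stripped at both ends. *)
Lemma count_words_rcons n (P : pred bitseq) :
  count P (words n.+1) =
    count (fun w => P (rcons w false)) (words n) + count (fun w => P (rcons w
        true)) (words n).
Proof.
elim: n P => [|n IHn] P; first by rewrite /= !addn0.
rewrite count_words_cons 2!IHn.
rewrite [X in _ = X + _]count_words_cons [X in _ = _ + X]count_words_cons.
exact: addnACA.
Qed.

Lemma count_words_rev n (P : pred bitseq) :
  count (fun w => P (rev w)) (words n) = count P (words n).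
Proof.
rewrite -count_map; apply/seq.permP/uniq_perm; rewrite ?words_uniq //.
  by rewrite map_inj_uniq ?words_uniq //; exact: can_inj revK.
move=> w; rewrite mem_words; apply/mapP/idP => [[v + ->]|sz_w].
  by rewrite mem_words size_rev.
by exists (rev w); rewrite ?revK // mem_words size_rev.
Qed.

(* Counts the letters of [peel lo w] equal to their index when indices start at
   [lo + e]: for [e > 0] an ascent places a letter too small to be fixed, and a
   descent places the largest remaining one, of value [lo + size v + 1]. *)
Fixpoint hits (e : nat) (w : bitseq) : nat :=
  if w is b :: v then
    if b then ((size v).+1 == e) + hits e.+1 v else hits e v
  else 0.

(** As long as only ascents are read, the least remaining letter equals its index, so each ascent
    gives a fixed point, and so does the final letter. The first descent leaves the indices one
    ahead of the least remaining letter, which is [hits] with excess 1. *)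
Fixpoint fix_of_word (w : bitseq) : nat :=
  if w is b :: v then
    if b then hits 1 v else (fix_of_word v).+1
  else 1.

(** The index [lo + e] already exceeds the greatest remaining letter [lo + size w], and it stays
    ahead. *)
Lemma hits_short e w : size w < e -> hits e w = 0.
Proof.
elim: w e => //= b w IHw e lt_w; case: b; last by apply: IHw; lia.
by rewrite IHw; [rewrite ltn_eqF | lia].
Qed.

(** Right after a hit the remaining word is shorter than the new excess, so [hits_short] excludes a
    second one. *)
Lemma hits_le1 e w : hits e w <= 1.
Proof.
elim: w e => //= -[] w IHw e //; case: eqP => [<-|_]; last exact: IHw.
by rewrite hits_short.
Qed.

(* Appending a letter shifts the value of every descent in step with [e]. *)
Lemma hits_rcons e w b : hits e.+2 (rcons w b) = hits e.+1 w.
Proof.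
elim: w e => [|c w IHw] e /=; first by case: b.
by rewrite size_rcons eqSS !IHw.
Qed.

Lemma count_split (T : Type) (c P : pred T) s :
  count (fun w => c w && P w) s + count (fun w => ~~ c w && P w) s = count P s.
Proof. by elim: s => //= x s <-; case: (c x) => /=; lia. Qed.

(* With h the left-hand count, splitting off the first letter, and after a first
   descent also the last letter, gives
   h(n+2,d) = h(n+1,d) + h(n,d-1) + h(n,d-2).  The arbitrary predicate [K] on
   the number of descents avoids truncated subtraction. *)
Lemma count_hits n (K : pred nat) :
  count (fun w => (hits 1 w == 1) && K (count id w)) (words n) =
  count (fun w => (pix_of_word w == 0) && K (count id w)) (words n).
Proof.
pose all_ m (L : pred nat) := count (fun w => L (count id w)) (words m).
pose h m (L : pred nat) :=
  count (fun w => (hits 1 w == 1) && L (count id w)) (words m).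
pose z m (L : pred nat) :=
  count (fun w => (pix_of_word w == 0) && L (count id w)) (words m).
pose nz m (L : pred nat) :=
  count (fun w => (pix_of_word w != 0) && L (count id w)) (words m).
have split_all m L : nz m L + z m L = all_ m L.
  by rewrite addnC; apply: count_split.
have z_rec m L : z m.+1 L = nz m (L \o S).
  rewrite {1}/z count_words_cons [X in X + _](_ : _ = 0) ?add0n.
    by apply: eq_count => w /=; case: (pix_of_word w == 0).
  exact: (count_pred0 (words m)).
have nz_rec m L : nz m.+1 L = all_ m L + z m (L \o S).
  rewrite {1}/nz count_words_cons; congr (_ + _).
  by apply: eq_count => w /=; case: (pix_of_word w == 0).
(* The leading descent is not a hit, because a letter follows it; it raises the excess to 2, and
   deleting the last letter by [hits_rcons] lowers it back to 1. *)
have h_rcons b m (L : pred nat) :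
    count (fun w => (hits 1 (true :: rcons w b) == 1) && L (count id (rcons w b)))
      (words m) = h m (fun d => L (b + d)).
  apply: eq_count => w /=; rewrite size_rcons hits_rcons -cats1 count_cat /= addn0.
  by rewrite add0n addnC.
have h_rec m L : h m.+2 L = h m.+1 L + (h m (L \o S) + h m (L \o S \o S)).
  rewrite {1}/h count_words_cons; congr (_ + _); rewrite count_words_rcons.
  by congr (_ + _); [apply: (h_rcons false _ (L \o S)) | apply: (h_rcons true _ (L
      \o S))].
rewrite -/(h n K) -/(z n K); elim/ltn_ind: n K => -[|[|n]] IHn K //.
(* Unfolding [z] and then [nz], and splitting [all_] into [nz + z], gives [z] the recurrence of
   [h]. *)
rewrite h_rec !IHn // !z_rec nz_rec -split_all; lia.
Qed.

(** The arbitrary [J] absorbs the increment caused by a leading ascent. After a leading descent both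
    statistics are 0 or 1, and [count_hits] compares how often they are 1. *)
Lemma fix_pix_words n (J : nat -> nat -> bool) :
  count (fun w => J (fix_of_word w) (count id w)) (words n) =
  count (fun w => J (pix_of_word w) (count id w)) (words n).
Proof.
elim: n J => // n IHn J; rewrite !count_words_cons.
congr (_ + _); first exact: (IHn (fun a b => J a.+1 b)).
pose K b d := J (nat_of_bool b) d.+1.
(* The joint count of a 0-1 statistic with the number of descents is determined by the words where
   it equals 1; the others are obtained by subtraction. *)
have bool_split (c : pred bitseq) :
    count (fun w => K (c w) (count id w)) (words n) =
    count (fun w => c w && K true (count id w)) (words n) +
    (count (fun w => K false (count id w)) (words n) -
     count (fun w => c w && K false (count id w)) (words n)).
  rewrite -(count_split c (fun w => K false _)) addKn -[LHS](count_split c).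
  by congr (_ + _); apply: eq_count => w /=; case: (c w).
transitivity (count (fun w => K (hits 1 w == 1) (count id w)) (words n)).
  by apply: eq_count => w; rewrite /K /=; case: (hits 1 w) (hits_le1 1 w) => [|[]].
by rewrite bool_split !count_hits -bool_split.
Qed.
(** * Permutations avoiding 213 and 231 *)

(** The word on an interval starting at [lo] that avoids 213 and 231 and has descent word [w]: an
    ascent removes the least remaining letter, a descent the greatest. *)
Fixpoint peel lo (w : bitseq) : seq nat :=
  if w is b :: v then
    if b then (lo + size v).+1 :: peel lo v else lo :: peel lo.+1 v
  else [:: lo].

Lemma iota_rcons m n : iota m n.+1 = rcons (iota m n) (m + n).
Proof. by rewrite -addn1 iotaD cats1. Qed.

Lemma perm_peel lo w : perm_eq (peel lo w) (iota lo (size w).+1).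
Proof.
elim: w lo => //= -[] w IHw lo; last by rewrite perm_cons IHw.
rewrite -[lo :: _]/(iota lo (size w).+2) iota_rcons addnS perm_sym perm_rcons.
by rewrite perm_cons perm_sym.
Qed.

Lemma mem_peel lo w y : (y \in peel lo w) = (lo <= y <= lo + size w).
Proof. by rewrite (perm_mem (perm_peel lo w)) mem_iota addnS. Qed.

Lemma size_peel lo w : size (peel lo w) = (size w).+1.
Proof. by rewrite (perm_size (perm_peel lo w)) size_iota. Qed.

Lemma descent_word_peel lo w : descent_word (peel lo w) = w.
Proof.
elim: w lo => //= b w IHw lo.
have descent_cons x l : descent_word (x :: peel l w) = (head 0 (peel l w) < x) :: w.
  by have := IHw l; case: (peel l w) (size_peel l w) => //= y t _ ->.
have bounds l : l <= head 0 (peel l w) <= l + size w.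
  by rewrite -mem_peel; case: (peel l w) (size_peel l w) => //= *; rewrite mem_head.
case: b; rewrite descent_cons; congr (_ :: _).
  by have := bounds lo; lia.
by have := bounds lo.+1; lia.
Qed.

Definition fixes_from c (s : seq nat) : nat :=
  count (fun i => nth 0 s i == c + i) (iota 0 (size s)).

Lemma fixes_from_cons c x s : fixes_from c (x :: s) = (x == c) + fixes_from c.+1 s.
Proof.
rewrite /fixes_from /= addn0 -[1]addn0 iotaDl count_map; congr (_ + _).
by apply: eq_count => i /=; rewrite addnS.
Qed.

Lemma fixes_peel_hits e lo w :
  0 < e -> fixes_from (lo + e) (peel lo w) = hits e w.
Proof.
elim: w e lo => [|b w IHw] e lo e_gt0 /=.
  by rewrite fixes_from_cons /fixes_from /= addn0; lia.
case: b; rewrite fixes_from_cons.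
  by rewrite -!addnS eqn_add2l IHw.
by rewrite -addSn IHw //; lia.
Qed.

Lemma word_fix_peel w : word_fix (peel 1 w) = fix_of_word w.
Proof.
rewrite -[LHS]/(fixes_from 1 _).
elim: w 1 => [|b w IHw] lo /=.
  by rewrite fixes_from_cons eqxx.
case: b; rewrite fixes_from_cons; last by rewrite IHw eqxx.
by rewrite -[in fixes_from _](addn1 lo) fixes_peel_hits //; lia.
Qed.

Lemma eq_pairwise_in (r r' : rel nat) s :
  {in s &, r =2 r'} -> pairwise r s = pairwise r' s.
Proof. by move=> eq_r; apply: (eq_in_pairwise eq_r); apply/allP. Qed.

Lemma pairwise_ascent_peel lo w :
  pairwise (fun y z => ~~ (y < z)) (peel lo w) = all id w.
Proof.
elim: w lo => //= -[] w IHw lo /=; rewrite IHw.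
  rewrite (_ : all _ _) //; apply/allP => y; rewrite mem_peel; lia.
apply/negbTE/negP => /andP[/allP/(_ lo.+1)].
by rewrite mem_peel leqnn leq_addr => /(_ isT).
Qed.

Lemma pairwise_descent_peel lo w :
  pairwise (fun y z => ~~ (z < y)) (peel lo w) = all negb w.
Proof.
elim: w lo => //= -[] w IHw lo /=; rewrite IHw.
  apply/negbTE/negP => /andP[/allP/(_ lo)].
  by rewrite mem_peel leqnn ltnS leq_addr => /(_ isT).
rewrite (_ : all _ _) //; apply/allP => y; rewrite mem_peel; lia.
Qed.

Lemma pairwiseT s : pairwise (fun _ _ : nat => true) s.
Proof. by elim: s => //= x s ->; rewrite all_predT. Qed.

(** A greatest letter cannot start 123, whereas a least letter starts one unless everything after it
    decreases, that is, unless no further ascent occurs. *)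
Lemma peel_avoid123 lo w :
  triplewise (fun x y z => ~~ (x < y < z)) (peel lo w) = (count negb w <= 1).
Proof.
elim: w lo => //= -[] w IHw lo /=; rewrite IHw.
  rewrite (eq_pairwise_in (r' := fun _ _ => true)) ?pairwiseT // => y z.
  by rewrite !mem_peel; lia.
rewrite (eq_pairwise_in (r' := fun y z => ~~ (y < z))).
  rewrite pairwise_ascent_peel -[all _ _]negbK -has_predC has_count.
  by rewrite (eq_count (a2 := negb)) //; case: (count _ _) => [|[]].
by move=> y z; rewrite !mem_peel; lia.
Qed.

Lemma peel_avoid321 lo w :
  triplewise (fun x y z => ~~ (z < y < x)) (peel lo w) = (count id w <= 1).
Proof.
elim: w lo => //= -[] w IHw lo /=; rewrite IHw; last first.
  rewrite (eq_pairwise_in (r' := fun _ _ => true)) ?pairwiseT // => y z.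
  by rewrite !mem_peel; lia.
rewrite (eq_pairwise_in (r' := fun y z => ~~ (z < y))).
  rewrite pairwise_descent_peel -[all _ _]negbK -has_predC has_count.
  rewrite (eq_count (a2 := id)); first by case: (count _ _) => [|[]].
  by move=> b /=; rewrite negbK.
by move=> y z; rewrite !mem_peel; lia.
Qed.

(** A greatest letter starts 312 unless everything after it decreases. Thus [pairwise implb]
    expresses that all ascents of [w] precede all descents. *)
Lemma peel_avoid312 lo w :
  triplewise (fun x y z => ~~ (y < z < x)) (peel lo w) = pairwise implb w.
Proof.
elim: w lo => //= -[] w IHw lo /=; rewrite IHw.
  rewrite (eq_pairwise_in (r' := fun y z => ~~ (y < z))).
    by rewrite pairwise_ascent_peel.
  by move=> y z; rewrite !mem_peel; lia.
rewrite (eq_pairwise_in (r' := fun _ _ => true)) ?pairwiseT.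
  by rewrite (_ : all _ _) //; apply/allP.
by move=> y z; rewrite !mem_peel; lia.
Qed.

Lemma peel_avoid213 lo w : triplewise (fun x y z => ~~ (y < x < z)) (peel lo w).
Proof.
elim: w lo => //= -[] w IHw lo /=; rewrite IHw andbT;
  rewrite (eq_pairwise_in (r' := fun _ _ => true)) ?pairwiseT // => y z;
  rewrite !mem_peel; lia.
Qed.

Lemma peel_avoid231 lo w : triplewise (fun x y z => ~~ (z < x < y)) (peel lo w).
Proof.
elim: w lo => //= -[] w IHw lo /=; rewrite IHw andbT;
  rewrite (eq_pairwise_in (r' := fun _ _ => true)) ?pairwiseT // => y z;
  rewrite !mem_peel; lia.
Qed.

(** If the first letter were neither least nor greatest, both extremes would come after it and
    complete a 213 or a 231, depending on their order. *)
Lemma peelP lo n s : perm_eq s (iota lo n.+1) ->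
  triplewise (fun x y z => ~~ (y < x < z)) s ->
  triplewise (fun x y z => ~~ (z < x < y)) s ->
  exists2 w, size w = n & s = peel lo w.
Proof.
elim: n lo s => [|n IHn] lo s s_iota.
  by move=> _ _; exists [::] => //; apply: (perm_small_eq _ s_iota).
case: s s_iota => [|x s] s_iota; first by have := perm_size s_iota.
have mem_s y : (y \in x :: s) = (lo <= y <= lo + n.+1).
  by rewrite (perm_mem s_iota) mem_iota addnS.
move=> /= /andP[av213 av213s] /andP[av231 av231s].
have [x_lo|x_nlo] := eqVneq x lo.
  case: (IHn lo.+1 s) => // [|w sz_w ->].
    by move: s_iota; rewrite x_lo perm_cons.
  by exists (false :: w); rewrite ?x_lo //= sz_w.
have [x_hi|x_nhi] := eqVneq x (lo + n.+1).
  case: (IHn lo s) => // [|w sz_w ->].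
    by move: s_iota; rewrite iota_rcons perm_sym perm_rcons x_hi perm_cons perm_sym.
  by exists (true :: w); rewrite ?x_hi //= sz_w ?addnS.
(* The conjunction of the two conditions is reflexive and symmetric, so it holds for any two letters
   of the tail, and the order of the two extremes need not be known. *)
pose r := [rel y z | ~~ (y < x < z) && ~~ (z < x < y)].
have: pairwise r s by rewrite (pairwise_relI (fun y z => ~~ (y < x < z))) av213.
rewrite pairwise_all2rel; last 2 first.
- by move=> y /=; lia.
- by move=> y z /=; rewrite andbC.
have mem_tail y : lo <= y <= lo + n.+1 -> y != x -> y \in s.
  by rewrite -mem_s inE => /orP[->|].
have := mem_head x s; rewrite mem_s => x_bounds.
move=> /allrelP/(_ lo (lo + n.+1)) /= => r_ends.
have := r_ends (mem_tail _ _ _) (mem_tail _ _ _).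
lia.
Qed.
(** * Counting over avoidance classes *)

Definition avoiders n Pi (L : seq (seq nat)) : Prop :=
  uniq L /\ forall s, (s \in L) = perm_eq s (iota 1 n) && avoids s Pi.

Lemma card_avoiders n Pi L (P : pred (seq nat)) : avoiders n Pi L ->
  #|[set p in Av n Pi | P (one_line p)]| = count P L.
Proof.
move=> [uniq_L mem_L]; rewrite cardE -(size_map (@one_line n)) -size_filter.
apply: perm_size; apply: uniq_perm; rewrite ?filter_uniq //.
  by rewrite map_inj_uniq ?enum_uniq //; exact: one_line_inj.
move=> s; rewrite mem_filter mem_L; apply/mapP/and3P => [[p]|[Ps s_n av_s]].
  by rewrite mem_enum !inE => /andP[av_p Pp] ->; rewrite perm_one_line.
have [p eq_s] := one_line_onto s_n; exists p => //.
by rewrite mem_enum !inE eq_s av_s Ps.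
Qed.

Lemma card_fix n Pi L j k : avoiders n Pi L ->
  #|[set p in Av n Pi | (fixs p == j) && (des p == k)]| =
  count (fun s => (word_fix s == j) && (count id (descent_word s) == k)) L.
Proof.
move=> /card_avoiders <-; apply: eq_card => p; rewrite !inE.
by rewrite fixs_one_line /des word_desE.
Qed.

Lemma card_pix n Pi L j k : avoiders n.+1 Pi L ->
  #|[set p in Av n.+1 Pi | (pix p == j) && (des p == k)]| =
  count (fun s => (pix_of_word (descent_word s) == j)
                  && (count id (descent_word s) == k)) L.
Proof.
move=> /card_avoiders <-; apply: eq_card => p; rewrite !inE.
rewrite /pix /des word_desE word_pixE ?one_line_uniq //.
by rewrite -size_eq0 size_one_line.
Qed.

Definition equidistributed n Pi : Prop := forall j k,
  #|[set p in Av n Pi | (fixs p == j) && (des p == k)]|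
    = #|[set p in Av n Pi | (pix p == j) && (des p == k)]|.

Lemma equidistributed0 Pi : equidistributed 0 Pi.
Proof.
move=> j k; apply: eq_card => p; rewrite !inE /pix.
have /size0nil -> := size_one_line p.
rewrite [fixs p](_ : _ = 0) //; apply/eqP; rewrite cards_eq0.
by apply/eqP/setP => -[].
Qed.

Definition balanced n (X : pred bitseq) : Prop := forall j k,
  count (fun w => X w && ((fix_of_word w == j) && (count id w == k))) (words n) =
  count (fun w => X w && ((pix_of_word w == j) && (count id w == k))) (words n).

(** Such a condition can be merged into the arbitrary predicate of [fix_pix_words]. *)
Lemma balanced_size_count n (X : pred bitseq) (J : nat -> nat -> bool) :
  (forall w, X w = J (size w) (count id w)) -> balanced n X.
Proof.
move=> X_J j k.
pose K a d := J n d && ((a == j) && (d == k)).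
transitivity (count (fun w => K (fix_of_word w) (count id w)) (words n)).
  by apply: eq_in_count => w; rewrite mem_words X_J => /eqP ->.
rewrite fix_pix_words.
by apply: eq_in_count => w; rewrite mem_words X_J => /eqP ->.
Qed.

(** Here the two statistics agree word by word: after the leading ascents only descents remain, and
    both values then depend on the parity of their number. *)
Lemma balanced_implb n : balanced n (pairwise implb).
Proof.
have hits_nseq d : hits 1 (nseq d true) = (pix_of_word (nseq d true) == 0).
  elim/ltn_ind: d => -[|[|d]] IHd //.
  have nseq_rcons : nseq d.+1 true = rcons (nseq d true) true.
    by rewrite -[d.+1]addn1 nseqD cats1.
  (* Removing the first descent raises the excess to 2 and removing the last one restores it to 1,
     so the value has period two in [d], as on the pix side. *)
  transitivity (hits 2 (nseq d.+1 true)); first by rewrite /= size_nseq.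
  rewrite nseq_rcons hits_rcons IHd //=.
  by case: (pix_of_word _) => [|[]].
have eq_stat w : pairwise implb w -> fix_of_word w = pix_of_word w.
  elim: w => //= -[] w IHw /andP[all_w sorted_w]; last by rewrite IHw.
  have /all_pred1P -> : all (pred1 true) w by apply: sub_all all_w => -[].
  exact: hits_nseq.
move=> j k; apply: eq_count => w /=.
by case: (boolP (pairwise implb w)) => //= /eq_stat ->.
Qed.

Section PeelClass.

Variables (n : nat) (Pi : seq (seq nat)) (Y : pred (seq nat)) (X : pred bitseq).

Hypothesis avoidsE : forall s, avoids s Pi =
  [&& triplewise (fun x y z => ~~ (y < x < z)) s,
      triplewise (fun x y z => ~~ (z < x < y)) s & Y s].
Hypothesis Y_peel : forall w, Y (peel 1 w) = X w.

Lemma peel_avoiders : avoiders n.+1 Pi [seq peel 1 w | w <- words n & X w].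
Proof.
split=> [|s].
  rewrite map_inj_uniq ?filter_uniq ?words_uniq //.
  exact: can_inj (descent_word_peel 1).
apply/mapP/andP => [[w + ->]|[s_n]].
  rewrite mem_filter mem_words => /andP[Xw /eqP <-].
  by rewrite perm_peel avoidsE peel_avoid213 peel_avoid231 Y_peel.
rewrite avoidsE => /and3P[av213 av231 Ys].
have [w sz_w eq_s] := peelP s_n av213 av231; exists w => //.
by rewrite mem_filter mem_words sz_w eqxx -Y_peel -eq_s Ys.
Qed.

Lemma peel_equidistributed : balanced n X -> equidistributed n.+1 Pi.
Proof.
move=> bal j k; rewrite (card_fix _ _ peel_avoiders) (card_pix _ _ peel_avoiders).
rewrite !count_map !count_filter.
have := bal j k; congr (_ = _); apply: eq_count => w /=;
  by rewrite ?word_fix_peel descent_word_peel andbC.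
Qed.

End PeelClass.

(** * Reverse-complement *)

Section ReverseComplement.

Variable n : nat.
Implicit Type s : seq nat.

Lemma perm_iota_bounds s y : perm_eq s (iota 1 n) -> y \in s -> 0 < y <= n.
Proof. by move=> s_n; rewrite (perm_mem s_n) mem_iota add1n. Qed.

Lemma rcK s : perm_eq s (iota 1 n) -> rc n (rc n s) = s.
Proof.
move=> s_n; rewrite /rc map_rev revK -map_comp -[RHS]map_id.
by apply/eq_in_map => y /(perm_iota_bounds s_n) /=; lia.
Qed.

Lemma perm_rc s : perm_eq s (iota 1 n) -> perm_eq (rc n s) (iota 1 n).
Proof.
move=> s_n; have mem_s := perm_iota_bounds s_n.
apply: uniq_perm; rewrite ?iota_uniq //.
  rewrite rev_uniq map_inj_in_uniq ?(perm_uniq s_n) ?iota_uniq //.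
  by move=> y z /mem_s + /mem_s; lia.
move=> y; rewrite mem_rev mem_iota; apply/mapP/idP => [[z /mem_s + ->]|y_n]; first
    by lia.
by exists (n.+1 - y); rewrite ?(perm_mem s_n) ?mem_iota; lia.
Qed.

(** Reverse-complement sends a fixed point [i] to the fixed point [n + 1 - i]. *)
Lemma word_fix_rc s : perm_eq s (iota 1 n) -> word_fix (rc n s) = word_fix s.
Proof.
move=> s_n; have sz : size s = n by rewrite (perm_size s_n) size_iota.
rewrite /word_fix size_rev size_map sz.
have rev_n : perm_eq (iota 0 n) [seq n.-1 - i | i <- iota 0 n].
  apply: uniq_perm; rewrite ?iota_uniq //.
    rewrite map_inj_in_uniq ?iota_uniq // => i j.
    by rewrite !mem_iota; lia.
  move=> i; rewrite mem_iota; apply/idP/mapP => [lt_i|[j + ->]].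
    by exists (n.-1 - i); rewrite ?mem_iota; lia.
  by rewrite mem_iota; lia.
rewrite [RHS](seq.permP rev_n) count_map; apply: eq_in_count => i.
rewrite mem_iota /= => lt_i.
rewrite nth_rev ?size_map ?sz // (nth_map 0) ?sz; last by lia.
have -> : n - i.+1 = n.-1 - i by lia.
have := perm_iota_bounds s_n (mem_nth 0 (_ : n.-1 - i < size s)).
rewrite sz; lia.
Qed.

Lemma nth_descent_word s i : i.+1 < size s ->
  nth false (descent_word s) i = (nth 0 s i.+1 < nth 0 s i).
Proof. by case: s => //= x t lt_i; rewrite (nth_pairmap 0). Qed.

(** Reversal and complement each exchange ascents with descents; together they only reverse the
    order of the positions. *)
Lemma descent_word_rc s : perm_eq s (iota 1 n) ->
  descent_word (rc n s) = rev (descent_word s).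
Proof.
move=> s_n; have sz : size s = n by rewrite (perm_size s_n) size_iota.
have szrc : size (rc n s) = n by rewrite size_rev size_map.
apply: (@eq_from_nth _ false) => [|i]; rewrite ?size_rev !size_descent_word szrc
    ?sz // => lt_i.
rewrite nth_rev ?size_descent_word ?sz // !nth_descent_word ?szrc ?sz; try lia.
rewrite !nth_rev ?size_map ?sz; try lia.
rewrite !(nth_map 0) ?sz; try lia.
have -> : n - i.+2 = n.-1 - i.+1 by lia.
have -> : n - i.+1 = (n.-1 - i.+1).+1 by lia.
have lt_j : (n.-1 - i.+1).+1 < size s by lia.
have := perm_iota_bounds s_n (mem_nth 0 lt_j).
have := perm_iota_bounds s_n (mem_nth 0 (ltnW lt_j)).
by move: (nth _ _ _) (nth _ _ _) => a b; lia.
Qed.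

Lemma triplewise_rc (r : nat -> nat -> nat -> bool) s :
  triplewise r (rc n s) =
  triplewise (fun x y z => r (n.+1 - z) (n.+1 - y) (n.+1 - x)) s.
Proof. by rewrite triplewise_rev triplewise_map. Qed.

Lemma rc_avoiders Pi Pi' L :
  (forall s, perm_eq s (iota 1 n) -> avoids s Pi' = avoids (rc n s) Pi) ->
  avoiders n Pi L -> avoiders n Pi' (map (rc n) L).
Proof.
move=> avE [uniq_L mem_L].
have L_n s : s \in L -> perm_eq s (iota 1 n) by rewrite mem_L => /andP[].
split=> [|s].
  rewrite map_inj_in_uniq // => s t /L_n s_n /L_n t_n eq_rc.
  by rewrite -(rcK s_n) eq_rc rcK.
apply/mapP/andP => [[t tL ->]|[s_n av_s]].
  have t_n := L_n _ tL; rewrite perm_rc // avE ?perm_rc // rcK //.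
  by move: tL; rewrite mem_L => /andP[].
by exists (rc n s); rewrite ?rcK // mem_L perm_rc // -avE.
Qed.

End ReverseComplement.

(** * Permutations avoiding 123, 312 and 321 *)

(* Erdos-Szekeres for five letters. *)
Lemma size_avoid_123_321 n Pi s :
  (forall s, avoids s Pi -> triplewise (fun x y z => ~~ (x < y < z)) s &&
     triplewise (fun x y z => ~~ (z < y < x)) s) ->
  perm_eq s (iota 1 n) -> avoids s Pi -> n < 5.
Proof.
move=> av s_n /av/andP[]; have := perm_size s_n; rewrite size_iota => <-.
have: uniq s by rewrite (perm_uniq s_n) iota_uniq.
case: s {s_n} => [|a [|b [|c [|d [|e s]]]]] //.
rewrite /= !inE.
case: (ltngtP a b); case: (ltngtP b c); rewrite ?orbT ?andbF //=;
case: (ltngtP c d); rewrite ?orbT ?andbF //=;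
case: (ltngtP d e); rewrite ?orbT ?andbF //=;
case: (ltngtP a c); rewrite ?orbT ?andbF //=;
case: (ltngtP b d); rewrite ?orbT ?andbF //=;
case: (ltngtP c e); rewrite ?orbT ?andbF //=;
case: (ltngtP a d); rewrite ?orbT ?andbF //=;
case: (ltngtP b e); rewrite ?orbT ?andbF //=;
case: (ltngtP a e); rewrite ?orbT ?andbF //=.
Qed.

Definition triples_123_312_321 s :=
  [&& triplewise (fun x y z => ~~ (x < y < z)) s,
      triplewise (fun x y z => ~~ (y < z < x)) s &
      triplewise (fun x y z => ~~ (z < y < x)) s].

Lemma equidistributed_123_312_321 n Pi :
  (forall s, avoids s Pi = triples_123_312_321 s) -> equidistributed n.+1 Pi.
Proof.
move=> avE j k.
have av_L : avoiders n.+1 Pi [seq s <- permutations (iota 1 n.+1) |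
    triples_123_312_321 s].
  split=> [|s]; first by rewrite filter_uniq ?permutations_uniq.
  by rewrite mem_filter mem_permutations avE andbC.
rewrite (card_fix _ _ av_L) (card_pix _ _ av_L).
have [lt_n|le_n] := ltnP n.+1 5; last first.
  rewrite [filter _ _](_ : _ = [::]) //; apply/nilP; rewrite /nilp size_filter
      -leqn0 leqNgt -has_count.
  apply/hasPn => s; rewrite mem_permutations => s_n; apply/negP; rewrite -avE =>
      av_s.
  have := size_avoid_123_321 _ s_n av_s; rewrite ltnNge le_n => /(_ _)/negP;
      apply=> // t.
  by rewrite avE => /and3P[-> _ ->].
pose J ab := (ab.1 == j) && (ab.2 == k).
(* Collecting the pairs of statistics in lists eliminates [j] and [k]. For each of the four sizes
   there remains a closed comparison of multisets, decided by computation. *)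
pose Lst (f : seq nat -> nat) := [seq (f s, count id (descent_word s)) |
   s <- permutations (iota 1 n.+1) & triples_123_312_321 s].
transitivity (count J (Lst word_fix)); first by rewrite count_map.
transitivity (count J (Lst (fun s => pix_of_word (descent_word s)))); last by
    rewrite count_map.
apply/seq.permP; rewrite /Lst.
by case: n lt_n {av_L Lst} => [|[|[|[|]]]] // _; vm_compute.
Qed.

(** * Permutations avoiding 132 and 321 *)

Lemma nth_rot_iota n r i : r <= n -> i < n ->
  nth 0 (rot r (iota 1 n)) i = if i < n - r then (r + i).+1 else (i - (n - r)).+1.
Proof.
move=> le_r lt_i; rewrite /rot nth_cat size_drop size_iota.
case: ltnP => lt_ir; first by rewrite nth_drop nth_iota //; lia.
by rewrite nth_take ?nth_iota //; lia.
Qed.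

(* The permutations of [1..n] avoiding 132 and 321 other than the identity. *)
Fixpoint extended_rotations n : seq (seq nat) :=
  if n is m.+1 then
    [seq rcons s m.+1 | s <- extended_rotations m] ++
    [seq rot r (iota 1 m.+1) | r <- iota 1 m]
  else [::].

Lemma extended_rotationsS n : extended_rotations n.+1 =
  [seq rcons s n.+1 | s <- extended_rotations n] ++
  [seq rot r (iota 1 n.+1) | r <- iota 1 n].
Proof. by []. Qed.

Definition triples_132_321 s :=
  triplewise (fun x y z => ~~ (x < z < y)) s &&
  triplewise (fun x y z => ~~ (z < y < x)) s.

(** Neither pattern ends with its greatest letter, so a final maximum takes part in no
    occurrence. *)
Lemma triples_132_321_rcons n s : perm_eq s (iota 1 n) ->
  triples_132_321 (rcons s n.+1) = triples_132_321 s.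
Proof.
move=> s_n; rewrite /triples_132_321 !triplewise_rcons.
have bound y : y \in s -> y <= n by move/(perm_iota_bounds s_n)/andP=> [].
rewrite (eq_pairwise_in (r' := fun _ _ => true)) ?pairwiseT; last first.
  by move=> x y /bound le_x /bound le_y /=; lia.
rewrite (eq_pairwise_in (r' := fun _ _ => true)) ?pairwiseT //.
by move=> x y /bound le_x /bound le_y /=; lia.
Qed.

Lemma triples_132_321_rot n r : r <= n -> triples_132_321 (rot r (iota 1 n)).
Proof.
move=> le_r; apply/andP; split; apply: triplewise_nth => i j k lt_ijk;
  rewrite size_rot size_iota => lt_k; rewrite !nth_rot_iota //; try lia.
- by case: (ltnP i); case: (ltnP j); case: (ltnP k); lia.
- by case: (ltnP i); case: (ltnP j); case: (ltnP k); lia.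
Qed.

(** With the maximum as the 3 of 132, every letter of [t] lies below every letter of [s]. With the
    maximum as the 3 of 321, [t] increases. A descending pair in [s] followed by a letter of [t]
    would be a 321, so [s] increases as well, which uses that [t] is nonempty. Hence [t], [s] and
    the maximum concatenate to the identity. *)
Lemma triples_132_321_split n s t :
  perm_eq (s ++ n.+1 :: t) (iota 1 n.+1) -> t != [::] ->
  triples_132_321 (s ++ n.+1 :: t) -> s ++ n.+1 :: t = rot (size t) (iota 1 n.+1).
Proof.
move=> st_n t_neq0 /andP[/triplewise_subseqP av132 /triplewise_subseqP av321].
have uniq_st : uniq (s ++ n.+1 :: t) by rewrite (perm_uniq st_n) iota_uniq.
move: (uniq_st); rewrite cat_uniq => /and3P[uniq_s /hasPn disj /andP[mt uniq_t]].
have sub_s x y z : subseq [:: x; y] s -> z \in n.+1 :: t ->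
    subseq [:: x; y; z] (s ++ n.+1 :: t).
  by move=> xy_s z_t; apply: (@cat_subseq _ [:: x; y] [:: z]); rewrite ?sub1seq.
have le_t y : y \in t -> y <= n.
  move=> y_t; have: y \in s ++ n.+1 :: t by rewrite mem_cat inE y_t !orbT.
  move/(perm_iota_bounds st_n) => y_n.
  have: y != n.+1 by apply: contraNneq mt => <-.
  lia.
have lt_ts x z : x \in s -> z \in t -> z < x.
  move=> x_s z_t; have := av132 x n.+1 z.
  rewrite (@cat_subseq _ [:: x] [:: n.+1; z]) ?sub1seq //=; last by rewrite eqxx
      sub1seq.
  have := disj z; rewrite inE z_t orbT => /(_ isT) z_s.
  have : x != z by apply: contraNneq z_s => <-.
  have := le_t _ z_t => le_z neq_xz /(_ isT).
  lia.
suff eq_iota : t ++ rcons s n.+1 = iota 1 n.+1.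
  by rewrite -eq_iota rot_size_cat cat_rcons.
apply: (irr_sorted_eq ltn_trans ltnn); last first.
- by move=> y; rewrite -(perm_mem st_n) !mem_cat mem_rcons !inE; rewrite [RHS]orbC
    -orbA orbCA.
- exact: iota_ltn_sorted.
rewrite (sorted_pairwise ltn_trans) pairwise_cat pairwise_rcons; apply/and4P; split.
- apply/allrelP => z x z_t; rewrite mem_rcons inE => /orP[/eqP ->|x_s]; last exact:
    lt_ts.
  by rewrite ltnS le_t.
- apply/pairwise_subseqP => y z yz_t.
  have := av321 n.+1 y z.
  rewrite (@cat_subseq _ [::] [:: n.+1; y; z]) ?sub0seq //=; last by rewrite eqxx.
  have /andP[] : uniq [:: y; z] := subseq_uniq yz_t uniq_t.
  rewrite inE => neq_yz _ /(_ isT).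
  have := le_t y (mem_subseq yz_t (mem_head _ _)); lia.
- apply/allP => x x_s.
  have: x \in s ++ n.+1 :: t by rewrite mem_cat x_s.
  move/(perm_iota_bounds st_n).
  have := disj n.+1 (mem_head _ _) => m_s.
  have : x != n.+1 by apply: contraNneq m_s => <-.
  lia.
- case: t t_neq0 sub_s lt_ts {st_n av132 uniq_st disj mt uniq_t le_t} av321 => // z
    t _ sub_s lt_ts av321.
  apply/pairwise_subseqP => x y xy_s.
  have := av321 x y z (sub_s _ _ _ xy_s _); rewrite !inE eqxx orbT => /(_ isT).
  have := lt_ts y z; rewrite mem_head (mem_subseq xy_s) ?inE ?eqxx ?orbT // => /(_
      isT isT).
  have /andP[] : uniq [:: x; y] := subseq_uniq xy_s uniq_s.
  rewrite inE; lia.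
Qed.

(** The word is split at its greatest letter: if nothing follows, that letter is removed and
    induction applies; otherwise the word is a rotation. *)
Lemma mem_extended_rotations n s :
  (s \in iota 1 n :: extended_rotations n) =
  perm_eq s (iota 1 n) && triples_132_321 s.
Proof.
elim: n s => [|n IHn] s.
  rewrite mem_seq1; apply/eqP/andP => [-> //|[/perm_size/size0nil //]].
have rcons_n t : t \in iota 1 n :: extended_rotations n ->
    perm_eq (rcons t n.+1) (iota 1 n.+1) && triples_132_321 (rcons t n.+1).
  rewrite IHn => /andP[t_n av_t]; rewrite triples_132_321_rcons // av_t andbT.
  by rewrite iota_rcons add1n -!cats1 perm_cat2r.
apply/idP/andP => [|[s_n av_s]].
  rewrite inE mem_cat => /or3P[/eqP ->|/mapP[t t_n ->]|/mapP[r + ->]].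
  - apply/andP; have := rcons_n _ (mem_head _ _).
    by rewrite -[in rcons _ _](add1n n) -iota_rcons.
  - by apply/andP/rcons_n; rewrite inE t_n orbT.
  - rewrite mem_iota => r_n; rewrite perm_rot perm_refl triples_132_321_rot //; lia.
have max_s : n.+1 \in s by rewrite (perm_mem s_n) mem_iota; lia.
case/path.splitPr: s / max_s s_n av_s => s t s_n av_s.
have iota_n : iota 1 n.+1 = rcons (iota 1 n) n.+1 by rewrite iota_rcons add1n.
have [t0|t_neq0] := eqVneq t [::].
  move: s_n av_s; rewrite t0 cats1 iota_n -[X in perm_eq X]cats1 -[X in perm_eq _
      X]cats1.
  rewrite perm_cat2r => s_n; rewrite (triples_132_321_rcons s_n) => av_s.
  have: s \in iota 1 n :: extended_rotations n by rewrite IHn s_n.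
  rewrite inE => /orP[/eqP -> | s_rot]; first by rewrite mem_head.
  by rewrite inE mem_cat; apply/or3P/Or32/mapP; exists s.
rewrite inE mem_cat; apply/or3P; apply: Or33; apply/mapP; exists (size t).
  have := perm_size s_n; rewrite size_cat size_iota /= mem_iota.
  have: 0 < size t by rewrite lt0n size_eq0.
  by move: (size t) (size s) => a b; lia.
exact: triples_132_321_split.
Qed.

Lemma descent_word_rcons s m : s != [::] -> all (ltn^~ m) s ->
  descent_word (rcons s m) = rcons (descent_word s) false.
Proof.
case: s => // x s _ lt_m; rewrite /= -!cats1 pairmap_cat /=.
have -> //: (m < last x s) = false.
by have := allP lt_m _ (mem_last x s); rewrite /=; lia.
Qed.

Lemma descent_word_iota m n : descent_word (iota m n.+1) = nseq n false.
Proof.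
elim: n m => //= n IHn m; have := IHn m.+1 => /= ->.
by rewrite ltnNge leqnSn.
Qed.

Lemma descent_word_rot r n : r < n ->
  descent_word (rot r.+1 (iota 1 n.+1)) = nseq (n - r.+1) false ++ true :: nseq r
      false.
Proof.
move=> lt_r; rewrite /rot drop_iota take_iota (minn_idPl _); last by lia.
have -> : n.+1 - r.+1 = (n - r.+1).+1 by lia.
rewrite -(descent_word_iota (1 + r.+1)) -(descent_word_iota 1) /= pairmap_cat /=.
congr (_ ++ _ :: _).
have := mem_last r.+2 (iota r.+3 (n - r.+1)).
rewrite -[_ :: _]/(iota r.+2 (n - r.+1).+1) mem_iota => /andP[le_last _].
exact: leq_trans le_last.
Qed.

Lemma pix_of_word_ascents a w :
  pix_of_word (nseq a false ++ w) = a + pix_of_word w.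
Proof. by elim: a => //= a ->. Qed.

(** The new letter lengthens the run of ascents after the last descent. That run has a positive
    value with or without it, and the descent before it only tests for zero. *)
Lemma pix_of_word_rcons w :
  true \in w -> pix_of_word (rcons w false) = pix_of_word w.
Proof.
elim: w => //= -[] w IHw; rewrite inE /=; last by move/IHw->.
have [/IHw -> //|no_true _] := boolP (true \in w).
have /all_pred1P -> : all (pred1 false) w.
  by apply/allP=> -[] // w_true; rewrite w_true in no_true.
have pix_nseq m : pix_of_word (nseq m false) = m.+1.
  by rewrite -[nseq m false]cats0 pix_of_word_ascents addn1.
have -> : rcons (nseq (size w) false) false = nseq (size w).+1 false.
  by rewrite -cats1 -(nseqD _ 1) addn1.
by rewrite !pix_nseq.
Qed.

Lemma word_fix_rcons s : word_fix (rcons s (size s).+1) = (word_fix s).+1.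
Proof.
rewrite /word_fix size_rcons iota_rcons -[rcons (iota _ _) _]cats1 count_cat /=
    nth_rcons ltnn !eqxx addn0 addn1.
congr _.+1; apply: eq_in_count => i; rewrite mem_iota /= => lt_i.
by rewrite nth_rcons lt_i.
Qed.

Lemma word_fix_iota n : word_fix (iota 1 n) = n.
Proof.
elim: n => // n IHn; rewrite iota_rcons add1n.
by have := word_fix_rcons (iota 1 n); rewrite size_iota IHn.
Qed.

Lemma word_fix_rot r n : r < n -> word_fix (rot r.+1 (iota 1 n.+1)) = 0.
Proof.
move=> lt_r; transitivity (count pred0 (iota 0 n.+1)); last exact: count_pred0.
rewrite /word_fix size_rot size_iota; apply: eq_in_count => i.
rewrite mem_iota => lt_i; rewrite nth_rot_iota; [|lia|lia].
by case: (ltnP i) => /=; lia.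
Qed.

Lemma extended_rotationsP n s : s \in extended_rotations n ->
  perm_eq s (iota 1 n) /\ true \in descent_word s.
Proof.
elim: n s => // n IHn s; rewrite mem_cat => /orP[/mapP[t t_n ->]|/mapP[[|r]]].
- have [perm_t desc_t] := IHn _ t_n; split.
    by rewrite iota_rcons add1n -!cats1 perm_cat2r.
  rewrite descent_word_rcons ?mem_rcons ?inE ?desc_t ?orbT //.
    by case: (t) desc_t.
  by apply/allP => y /(perm_iota_bounds perm_t) /=; lia.
- by rewrite mem_iota.
- rewrite mem_iota => r_n ->; split; first by rewrite perm_rot.
  by rewrite descent_word_rot ?mem_cat ?mem_head ?orbT //; lia.
Qed.

Lemma extended_rotations_uniq n : uniq (iota 1 n :: extended_rotations n).
Proof.
rewrite cons_uniq; apply/andP; split.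
  apply/negP => /extended_rotationsP[_]; case: n => // n.
  by rewrite descent_word_iota mem_nseq andbF.
elim: n => // n IHn; rewrite extended_rotationsS cat_uniq.
rewrite map_inj_uniq ?IHn; last exact: rcons_injl.
apply/and3P; split=> //.
  apply/hasPn => _ /mapP[r r_n ->]; apply/mapP => -[t t_n eq_rot].
  move: r_n; rewrite mem_iota => r_n.
  have: nth 0 (rot r (iota 1 n.+1)) n = n.+1.
    rewrite eq_rot nth_rcons; have [/perm_size -> _] := extended_rotationsP t_n.
    by rewrite size_iota ltnn eqxx.
  by rewrite nth_rot_iota; [case: (ltnP n (n.+1 - r)); lia | lia..].
rewrite map_inj_in_uniq ?iota_uniq // => r r'; rewrite !mem_iota => r_n r'_n eq_rot.
have: nth 0 (rot r (iota 1 n.+1)) 0 = nth 0 (rot r' (iota 1 n.+1)) 0 by rewrite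
    eq_rot.
rewrite !nth_rot_iota; [|lia..].
by case: (ltnP 0 (n.+1 - r)); case: (ltnP 0 (n.+1 - r')); lia.
Qed.

Lemma count_fix_rotations n (J : nat -> nat -> bool) :
  count (fun s => J (word_fix s) (count id (descent_word s))) (extended_rotations
      n.+1) =
  count (fun s => J (word_fix s).+1 (count id (descent_word s)))
      (extended_rotations n)
  + n * J 0 1.
Proof.
rewrite extended_rotationsS count_cat !count_map; congr (_ + _).
  apply: eq_in_count => s /extended_rotationsP[s_n desc_s] /=.
  have sz : size s = n by rewrite (perm_size s_n) size_iota.
  rewrite descent_word_rcons; last 2 first.
  - by case: (s) desc_s.
  - by apply/allP => y /(perm_iota_bounds s_n) /=; lia.
  by rewrite -sz word_fix_rcons -cats1 count_cat !addn0.
transitivity (count (fun _ => J 0 1) (iota 1 n)).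
  apply: eq_in_count => -[|r]; rewrite mem_iota //= => r_n.
  rewrite -[_ :: iota 2 n]/(iota 1 n.+1) word_fix_rot ?descent_word_rot; try lia.
  by rewrite count_cat /= !count_nseq !mul0n.
by case: (J 0 1); rewrite ?count_predT ?count_pred0 ?size_iota ?muln1 ?muln0.
Qed.

(** An appended maximum keeps pix, and the rotation by [r] has [n - r] ascents before its only
    descent. For fix, by contrast, the maximum adds one and every rotation contributes 0. *)
Lemma count_pix_rotations n (J : nat -> nat -> bool) :
  count (fun s => J (pix_of_word (descent_word s)) (count id (descent_word s)))
    (extended_rotations n.+1) =
  count (fun s => J (pix_of_word (descent_word s)) (count id (descent_word s)))
    (extended_rotations n)
  + count (fun r => J (n - r) 1) (iota 1 n).
Proof.
rewrite extended_rotationsS count_cat !count_map; congr (_ + _).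
  apply: eq_in_count => s /extended_rotationsP[s_n desc_s] /=.
  have sz : size s = n by rewrite (perm_size s_n) size_iota.
  rewrite descent_word_rcons; last 2 first.
  - by case: (s) desc_s.
  - by apply/allP => y /(perm_iota_bounds s_n) /=; lia.
  by rewrite pix_of_word_rcons // -cats1 count_cat !addn0.
apply: eq_in_count => -[|r]; rewrite mem_iota //= => r_n.
rewrite -[_ :: iota 2 n]/(iota 1 n.+1) descent_word_rot; last by lia.
rewrite pix_of_word_ascents /= -[nseq r false]cats0 pix_of_word_ascents addn1 addn0.
by rewrite cats0 count_cat /= !count_nseq !mul0n.
Qed.

(** The recurrences for fix and pix have different shapes; [pix_rec] shows that the pix counts also
    satisfy the one for fix. *)
Lemma fix_pix_rotations n (J : nat -> nat -> bool) :
  count (fun s => J (word_fix s) (count id (descent_word s))) (extended_rotations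
      n) =
  count (fun s => J (pix_of_word (descent_word s)) (count id (descent_word s)))
    (extended_rotations n).
Proof.
have pix_rec m K :
    count (fun s => K (pix_of_word (descent_word s)) (count id (descent_word s)))
      (extended_rotations m.+1) =
    count (fun s => K (pix_of_word (descent_word s)).+1 (count id (descent_word s)))
      (extended_rotations m) + m * K 0 1.
  elim: m => // m IHm; rewrite count_pix_rotations IHm.
  (* The rotation by [m + 1] contributes [K 0 1]; the others have the pix values of the rotations
     one size smaller, each raised by one. *)
  rewrite (count_pix_rotations m (fun a => K a.+1)) iota_rcons -cats1 count_cat /=.
  rewrite add1n subnn (eq_in_count (a2 := fun r => K (m - r).+1 1)).
    by rewrite mulSn addn0 (addnC (K 0 1 : nat)) addnACA.
  by move=> r; rewrite mem_iota => r_m /=; congr (K _ _); lia.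
elim: n J => // n IHn J.
by rewrite count_fix_rotations pix_rec (IHn (fun a => J a.+1)).
Qed.

Lemma equidistributed_132_321 n Pi :
  (forall s, avoids s Pi = triples_132_321 s) -> equidistributed n.+1 Pi.
Proof.
move=> avE j k.
have av_L : avoiders n.+1 Pi (iota 1 n.+1 :: extended_rotations n.+1).
  by split=> [|s]; rewrite ?extended_rotations_uniq // mem_extended_rotations avE.
rewrite (card_fix _ _ av_L) (card_pix _ _ av_L).
have count_cons P (x : seq nat) s : count P (x :: s) = P x + count P s by [].
rewrite !count_cons (fix_pix_rotations n.+1 (fun a d => (a == j) && (d == k))).
congr (_ + _).
rewrite word_fix_iota descent_word_iota -[nseq n false]cats0 pix_of_word_ascents.
by rewrite addn1.
Qed.

(** * Classes avoiding 132 and 312, by reverse-complement *)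

Section PeelClassDual.

Variables (n : nat) (Pi Pi' : seq (seq nat)) (Y : pred (seq nat)) (X : pred bitseq).

Hypothesis avoidsE : forall s, avoids s Pi =
  [&& triplewise (fun x y z => ~~ (y < x < z)) s,
      triplewise (fun x y z => ~~ (z < x < y)) s & Y s].
Hypothesis Y_peel : forall w, Y (peel 1 w) = X w.
Hypothesis X_rev : forall w, X (rev w) = X w.
Hypothesis avoids_rc : forall s,
  perm_eq s (iota 1 n.+1) -> avoids s Pi' = avoids (rc n.+1 s) Pi.

(** Reverse-complement preserves fix and des but reverses the descent word, which can change pix.
    The fix side is therefore moved to the class of [Pi] and exchanged for pix there by [balanced];
    then all descent words are reversed, which preserves their set by [X_rev] and their numbers of
    descents. *)
Lemma peel_equidistributed_rc : balanced n X -> equidistributed n.+1 Pi'.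
Proof.
move=> bal j k; have av_L := peel_avoiders n avoidsE Y_peel.
have av_L' := rc_avoiders avoids_rc av_L.
have L_n s : s \in [seq peel 1 w | w <- words n & X w] -> perm_eq s (iota 1 n.+1).
  by rewrite av_L.2 => /andP[].
rewrite (card_fix _ _ av_L') (card_pix _ _ av_L') [LHS]count_map [RHS]count_map.
transitivity (count (fun w => X w && ((fix_of_word w == j) && (count id w == k)))
    (words n)).
  transitivity (count (fun s => (word_fix s == j) && (count id (descent_word s) ==
      k)) [seq peel 1 w | w <- words n & X w]).
    apply: eq_in_count => s /L_n s_n /=.
    by rewrite word_fix_rc // descent_word_rc // count_rev.
  rewrite count_map count_filter; apply: eq_count => w /=.
  by rewrite word_fix_peel descent_word_peel andbC.
rewrite bal -count_words_rev.
transitivity (count (fun s => (pix_of_word (rev (descent_word s)) == j) && (count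
    id (descent_word s) == k)) [seq peel 1 w | w <- words n & X w]).
  rewrite count_map count_filter; apply: eq_count => w /=.
  by rewrite descent_word_peel X_rev count_rev andbC.
apply: eq_in_count => s /L_n s_n /=.
by rewrite descent_word_rc // count_rev.
Qed.

End PeelClassDual.

(** * The nine sets of patterns *)

Theorem theorem1p3 (Pi : seq (seq nat))
  (hPi : Pi \in
    [:: [:: [:: 1; 3; 2]; [:: 3; 1; 2]];
        [:: [:: 1; 3; 2]; [:: 3; 2; 1]];
        [:: [:: 2; 1; 3]; [:: 2; 3; 1]];
        [:: [:: 1; 2; 3]; [:: 1; 3; 2]; [:: 3; 1; 2]];
        [:: [:: 1; 2; 3]; [:: 2; 1; 3]; [:: 2; 3; 1]];
        [:: [:: 1; 2; 3]; [:: 3; 1; 2]; [:: 3; 2; 1]];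
        [:: [:: 1; 3; 2]; [:: 3; 1; 2]; [:: 3; 2; 1]];
        [:: [:: 2; 1; 3]; [:: 2; 3; 1]; [:: 3; 1; 2]];
        [:: [:: 2; 1; 3]; [:: 2; 3; 1]; [:: 3; 2; 1]]])
  (n j k : nat) :
  #|[set p in Av n Pi | (fixs p == j) && (des p == k)]|
    = #|[set p in Av n Pi | (pix p == j) && (des p == k)]|.
Proof.
case: n => [|n]; first exact: equidistributed0.
suff: equidistributed n.+1 Pi by apply.
pose c123 s := triplewise (fun x y z => ~~ (x < y < z)) s.
pose c321 s := triplewise (fun x y z => ~~ (z < y < x)) s.
pose c312 s := triplewise (fun x y z => ~~ (y < z < x)) s.
have avE s := avoid3E s.
(* The number of ascents is the length minus the number of descents, which brings avoidance of 123
   within reach of [balanced_size_count]. *)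
have le1_neg (w : bitseq) : (count negb w <= 1) = (size w - count id w <= 1).
  by rewrite -(count_predC id w) addKn.
(* Reverse-complement exchanges 132 with 213 and 312 with 231, and fixes 123 and 321. *)
have rcE s : perm_eq s (iota 1 n.+1) ->
  [/\ triplewise (fun x y z => ~~ (y < x < z)) (rc n.+1 s) =
        triplewise (fun x y z => ~~ (x < z < y)) s,
      triplewise (fun x y z => ~~ (z < x < y)) (rc n.+1 s) =
        triplewise (fun x y z => ~~ (y < z < x)) s,
      c123 (rc n.+1 s) = c123 s & c321 (rc n.+1 s) = c321 s].
  move=> s_n; split; rewrite /c123 /c321 triplewise_rc; apply: eq_in_triplewise;
    move=> x y z /(perm_iota_bounds s_n) ? /(perm_iota_bounds s_n) ?
        /(perm_iota_bounds s_n) ? /=;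
    lia.
have bal_all := @balanced_size_count n xpredT (fun _ _ => true) (fun=> erefl).
have bal_asc := @balanced_size_count n _ (fun m d => m - d <= 1) le1_neg.
have bal_des := @balanced_size_count n _ (fun _ d => d <= 1) (fun=> erefl).
have rev_count (a : pred bool) w : (count a (rev w) <= 1) = (count a w <= 1).
  by rewrite count_rev.
move: hPi; rewrite !inE => /or4P[/eqP->|/eqP->|/eqP->|].
- apply: (peel_equidistributed_rc (Pi := [:: [:: 2; 1; 3]; [:: 2; 3; 1]]) (Y :=
    xpredT) _ _ _ _ bal_all) => // s;
   rewrite /avoids /=.
  + by have [? ? -> -> [? ?]] := avE s.
  + move=> s_n; have [? ? -> -> [? ?]] := avE (rc n.+1 s).
    by have [? -> ? ? [-> ?]] := avE s; have [-> -> ? ?] := rcE s s_n.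
- apply: equidistributed_132_321 => s; rewrite /avoids /=.
  by have [? -> ? ? [? ->]] := avE s; rewrite andbT.
- apply: (peel_equidistributed (Y := xpredT) _ _ bal_all) => // s; rewrite /avoids
    /=.
  by have [? ? -> -> [? ?]] := avE s.
move=> /or4P[/eqP->|/eqP->|/eqP->|/or3P[]/eqP->].
- apply: (peel_equidistributed_rc (Pi := [:: [:: 1; 2; 3]; [:: 2; 1; 3]; [:: 2; 3;
    1]]) (Y := c123) _ (peel_avoid123 1) (rev_count _) _ bal_asc) => // s;
   rewrite /avoids /=.
  + by have [-> ? -> -> [? ?]] := avE s; rewrite andbT andbC -andbA.
  + move=> s_n; have [-> ? -> -> [? ?]] := avE (rc n.+1 s).
    by have [-> -> ? ? [-> ?]] := avE s; have [-> -> ] := rcE s s_n; rewrite /c123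
        => -> _.
- apply: (peel_equidistributed (Y := c123) _ (peel_avoid123 1) bal_asc) => // s;
    rewrite /avoids /=.
  by have [-> ? -> -> [? ?]] := avE s; rewrite andbT andbC -andbA.
- apply: equidistributed_123_312_321 => s; rewrite /avoids /=.
  by have [-> ? ? ? [-> ->]] := avE s; rewrite andbT.
- apply: (peel_equidistributed_rc (Pi := [:: [:: 2; 1; 3]; [:: 2; 3; 1]; [:: 3; 2;
    1]]) (Y := c321) _ (peel_avoid321 1) (rev_count _) _ bal_des) => // s;
   rewrite /avoids /=.
  + by have [? ? -> -> [? ->]] := avE s; rewrite andbT.
  + move=> s_n; have [? ? -> -> [? ->]] := avE (rc n.+1 s).
    by have [? -> ? ? [-> ->]] := avE s; have [-> -> _] := rcE s s_n; rewrite /c321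
        => ->.
- apply: (peel_equidistributed (Y := c312) _ (peel_avoid312 1) (@balanced_implb n))
    => // s; rewrite /avoids /=.
  by have [? ? -> -> [-> ?]] := avE s; rewrite andbT.
- apply: (peel_equidistributed (Y := c321) _ (peel_avoid321 1) bal_des) => // s;
    rewrite /avoids /=.
  by have [? ? -> -> [? ->]] := avE s; rewrite andbT.
Qed.
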